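(* Let $\Gamma$ be a non-trivial, torsion-free, countable abelian group. Then every orbit of the conjugation action of $\mathrm{Iso}(\mathbb{U})$ on $\mathrm{Hom}(\Gamma,\mathrm{Iso}(\mathbb{U}))$ (i.e., every conjugacy class) is meager in $\mathrm{Hom}(\Gamma,\mathrm{Iso}(\mathbb{U}))$.
   Context: $\mathrm{Iso}(\mathbb{U})$ is the isometry group of the Urysohn space with the pointwise convergence topology. $\mathrm{Hom}(\Gamma,G)$ has the topology from $G^\Gamma$, and $G$ acts on it by $(g\cdot\pi)(\gamma)=g\pi(\gamma)g^{-1}$. *)

(* Defs.v *)
From HB Require Import structures.
From mathcomp Require Import all_boot all_algebra.
From Stdlib Require Import Reals List.
Set Implicit Arguments. Unset Strict Implicit. Unset Printing Implicit Defensive.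
Import GRing.Theory.
Local Open Scope R_scope.

Definition is_metric (U : Type) (d : U -> U -> R) : Prop :=
  (forall x y, 0 <= d x y) /\ (forall x y, d x y = 0 <-> x = y) /\
  (forall x y, d x y = d y x) /\ (forall x y z, d x z <= d x y + d y z).

Definition cauchy_seq (U : Type) (d : U -> U -> R) (u : nat -> U) : Prop :=
  forall eps, 0 < eps -> exists N, forall m n, (N <= m)%nat -> (N <= n)%nat ->
    d (u m) (u n) < eps.

Definition converges_to (U : Type) (d : U -> U -> R) (u : nat -> U) (l : U) :=
  forall eps, 0 < eps -> exists N, forall n, (N <= n)%nat -> d (u n) l < eps.

Definition complete_metric (U : Type) (d : U -> U -> R) : Prop :=
  forall u, cauchy_seq d u -> exists l, converges_to d u l.

Definition separable_metric (U : Type) (d : U -> U -> R) : Prop :=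
  exists s : nat -> U, forall x eps, 0 < eps -> exists n, d x (s n) < eps.

(* Urysohn (finite) extension property: every Katetov function on a finite
   subset of U is realized by a point of U. *)
Definition urysohn_extension (U : Type) (d : U -> U -> R) : Prop :=
  forall (n : nat) (x : 'I_n -> U) (r : 'I_n -> R),
    (forall i j, r i - r j <= d (x i) (x j) /\ d (x i) (x j) <= r i + r j) ->
    exists y, forall i, d y (x i) = r i.

(* The Urysohn space: a complete separable metric space with the extension
   property (unique up to isometry). *)
Definition is_urysohn_space (U : Type) (d : U -> U -> R) : Prop :=
  is_metric d /\ complete_metric d /\ separable_metric d /\ urysohn_extension d.

Definition isometry (U : Type) (d : U -> U -> R) (f : U -> U) : Prop :=
  forall x y, d (f x) (f y) = d x y.

Definition in_Iso (U : Type) (d : U -> U -> R) (f : U -> U) : Prop :=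
  isometry d f /\ forall y, exists x, f x = y.

Definition is_hom (G : zmodType) (U : Type) (d : U -> U -> R)
    (p : G -> U -> U) : Prop :=
  (forall a : G, in_Iso d (p a)) /\ (forall a b x, p (GRing.add a b) x = p a (p b x)).

Definition HomT (G : zmodType) (U : Type) (d : U -> U -> R) :=
  { p : G -> U -> U | is_hom d p }.
Arguments HomT : clear implicits.

(* topology on Hom(Gamma, Iso(U)) induced from the product topology on
   Iso(U)^Gamma, Iso(U) carrying the pointwise convergence topology *)
Definition hom_open (G : zmodType) (U : Type) (d : U -> U -> R)
    (O : HomT G U d -> Prop) : Prop :=
  forall p, O p -> exists (F : list (G * U)) (eps : R), 0 < eps /\
    forall q : HomT G U d,
      (forall gx, In gx F -> d (proj1_sig q gx.1 gx.2) (proj1_sig p gx.1 gx.2) < eps) ->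
      O q.

Definition nowhere_dense (T : Type) (opn : (T -> Prop) -> Prop) (N : T -> Prop) :=
  forall O, opn O -> (exists t, O t) ->
    exists O', opn O' /\ (exists t, O' t) /\ (forall t, O' t -> O t /\ ~ N t).

Definition meager (T : Type) (opn : (T -> Prop) -> Prop) (A : T -> Prop) :=
  exists N : nat -> T -> Prop, (forall n, nowhere_dense opn (N n)) /\
    forall t, A t -> exists n, N n t.

Definition conj_orbit (G : zmodType) (U : Type) (d : U -> U -> R)
    (p : HomT G U d) : HomT G U d -> Prop :=
  fun q => exists g ginv : U -> U, isometry d g /\
    (forall x, g (ginv x) = x) /\ (forall x, ginv (g x) = x) /\
    forall (a : G) x, proj1_sig q a x = g (proj1_sig p a (ginv x)).

(* Main.v *)
(** Fix a nonzero [a] of [Gamma]. If [p a] is not the identity, some point is moved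
    by a fixed amount by [p (n a)] for all [n] in an infinite set [S], and this passes
    to conjugates; if [p a] is the identity, so it is on the whole orbit. So it
    suffices that every action is a limit of actions with [n a] trivial for some
    [n] in [S], and a limit of actions with [a] nontrivial.

    To approximate an action, add [eps] to the distances between distinct points of
    finitely many orbits. With [chi : Gamma -> R] a homomorphism such that
    [chi a = 1] and [c] small, the maximum of this metric and of [c * |chi|] is
    unchanged on a given finite set but large along the multiples of [a], so that for
    large [n] the quotient pseudometric by [<n a>] still agrees with it there. An
    invariant pseudometric on [nat * Gamma], partially embedded in the Urysohn
    space, then extends to an action on the whole space by a back-and-forth: a
    point of the Urysohn space is added as a new orbit of Katetov functions, a point
    of [nat * Gamma] is realized by the extension property. *)

Require Import Defs.
From mathcomp Require Import all_boot all_algebra.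
From Stdlib Require Import Reals Lra List Classical ClassicalEpsilon.

Set Implicit Arguments.
Unset Strict Implicit.
Unset Printing Implicit Defensive.
Import GRing.Theory.
Local Open Scope R_scope.

(** * Choice and finite bounds *)

Lemma dependent_choice (A : Type) (step : nat -> A -> A -> Prop) (a0 : A) :
  (forall n a, exists b, step n a b) ->
  exists f : nat -> A, f 0%nat = a0 /\ forall n, step n (f n) (f n.+1).
Proof.
move=> H.
pose next n a := proj1_sig (constructive_indefinite_description _ (H n a)).
exists (fix f n := if n is m.+1 then next m (f m) else a0); split=> // n.
by rewrite /next; case: constructive_indefinite_description.
Qed.

Lemma finite_bound (X : Type) (f : X -> R) (A : list X) :
  exists M, 0 <= M /\ forall x, In x A -> f x <= M.
Proof.
elim: A => [|x A [M [M0 HM]]]; first by exists 0; split; [lra|].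
exists (Rmax M (f x)); split; first by apply: Rle_trans (Rmax_l _ _).
move=> y [<-|Hy]; first exact: Rmax_r.
by apply: Rle_trans (HM _ Hy) (Rmax_l _ _).
Qed.

Lemma finite_bound2 (X : Type) (f : X -> X -> R) (A : list X) :
  exists M, 0 <= M /\ forall x y, In x A -> In y A -> f x y <= M.
Proof.
have [M [M0 HM]] := finite_bound (fun p => f p.1 p.2) (list_prod A A).
exists M; split=> // x y Hx Hy; apply: (HM (x, y)).
by apply/in_prod_iff.
Qed.

(** * Infima of real-valued families *)

Definition is_glb (I : Type) (P : I -> Prop) (f : I -> R) (m : R) : Prop :=
  (forall i, P i -> m <= f i) /\ forall l, (forall i, P i -> l <= f i) -> l <= m.

(** The choice operator makes this total; it is the infimum only for an inhabited family bounded
    below. *)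
Definition glb (I : Type) (P : I -> Prop) (f : I -> R) : R :=
  epsilon (inhabits 0) (is_glb P f).

Section Glb.
Variables (I : Type) (P : I -> Prop) (f : I -> R).
Hypotheses (f_ge0 : forall i, P i -> 0 <= f i) (P_inh : exists i, P i).

Lemma glb_spec : is_glb P f (glb P f).
Proof.
have [i0 Pi0] := P_inh.
have [||m [Hub Hle]] := completeness (fun l => forall i, P i -> l <= f i).
- by exists (f i0) => l; apply.
- by exists 0; apply: f_ge0.
apply: epsilon_spec; exists m; split=> [i Pi|l Hl]; last exact: Hub.
by apply: Hle => l; apply.
Qed.

Lemma glb_le i : P i -> glb P f <= f i.
Proof. exact: (proj1 glb_spec). Qed.

Lemma le_glb l : (forall i, P i -> l <= f i) -> l <= glb P f.
Proof. exact: (proj2 glb_spec). Qed.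

End Glb.

(** * Pseudometrics and Katetov functions *)

Definition pseudo_metric (X : Type) (r : X -> X -> R) : Prop :=
  (forall x, r x x = 0) /\ (forall x y, r x y = r y x) /\
  (forall x y z, r x z <= r x y + r y z).

Lemma pseudo_metric_ge0 (X : Type) (r : X -> X -> R) :
  pseudo_metric r -> forall x y, 0 <= r x y.
Proof. by move=> [r0 [rC rT]] x y; have := rT x y x; rewrite r0 (rC y x); lra. Qed.

Lemma metric_pseudo (U : Type) (d : U -> U -> R) : is_metric d -> pseudo_metric d.
Proof. by move=> [_ [d0 [dC dT]]]; split=> // x; apply/d0. Qed.

Definition katetov_on (X : Type) (r : X -> X -> R) (A : X -> Prop) (f : X -> R) :=
  forall x y, A x -> A y -> f x - f y <= r x y /\ r x y <= f x + f y.

Definition katetov (X : Type) (r : X -> X -> R) (f : X -> R) : Prop :=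
  forall x y, f x - f y <= r x y /\ r x y <= f x + f y.

(** The largest 1-Lipschitz extension of a Katetov function on [A] to the whole space. *)
Definition katetov_ext (X : Type) (r : X -> X -> R) (A : X -> Prop) (f : X -> R) x :=
  glb A (fun a => f a + r a x).

Section Katetov.
Variables (X : Type) (r : X -> X -> R).
Hypothesis r_pm : pseudo_metric r.

Lemma katetov_ge0 A f x : katetov_on r A f -> A x -> 0 <= f x.
Proof. by move=> /(_ x x) H Ax; have := H Ax Ax; rewrite (proj1 r_pm); lra. Qed.

Lemma katetov_dist x : katetov r (r x).
Proof.
have [_ [rC rT]] := r_pm => y z; have := rT x z y; have := rT y x z.
by rewrite (rC y x) (rC z y); lra.
Qed.

Section Extension.
Variables (A : X -> Prop) (f : X -> R).
Hypotheses (A_inh : exists a, A a) (fK : katetov_on r A f).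

Let f_ge0 x : forall a, A a -> 0 <= f a + r a x.
Proof.
move=> a Aa; have := katetov_ge0 fK Aa; have := pseudo_metric_ge0 r_pm a x; lra.
Qed.

Let ext_le x a : A a -> katetov_ext r A f x <= f a + r a x.
Proof. exact: (glb_le (f_ge0 x) A_inh). Qed.

Let le_ext x l : (forall a, A a -> l <= f a + r a x) -> l <= katetov_ext r A f x.
Proof. exact: (le_glb (f_ge0 x) A_inh). Qed.

Lemma katetov_ext_id a : A a -> katetov_ext r A f a = f a.
Proof.
move=> Aa; apply: Rle_antisym.
  by have := ext_le a Aa; rewrite (proj1 r_pm a); lra.
apply: le_ext => b Ab; have := fK Aa Ab.
by rewrite (proj1 (proj2 r_pm) a b); lra.
Qed.

Lemma katetov_ext_katetov : katetov r (katetov_ext r A f).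
Proof.
have [r0 [rC rT]] := r_pm => x y; split.
  suff : katetov_ext r A f x - r x y <= katetov_ext r A f y by lra.
  apply: le_ext => a Aa; have := ext_le x Aa; have := rT a y x.
  by rewrite (rC y x); lra.
suff : r x y - katetov_ext r A f y <= katetov_ext r A f x by lra.
apply: le_ext => a Aa.
suff : r x y - (f a + r a x) <= katetov_ext r A f y by lra.
apply: le_ext => b Ab; have := fK Aa Ab; have := rT x a y; have := rT a b y.
by rewrite (rC x a); lra.
Qed.

End Extension.

(* The sup distance of two Katetov functions is finite: by the Katetov
   inequalities it is at most [f x + g x] for every [x]. *)
Definition sup_dist (f g : X -> R) : R :=
  glb (fun m => forall x, Rabs (f x - g x) <= m) id.

Section SupDist.
Variables (f g : X -> R) (x0 : X).
Hypotheses (fK : katetov r f) (gK : katetov r g).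

Let bounds_inh : exists m, forall x, Rabs (f x - g x) <= m.
Proof.
exists (f x0 + g x0) => y; have := fK y x0; have := gK y x0.
rewrite (proj1 (proj2 r_pm) y x0) => H1 H2.
have := fK x0 y; have := gK x0 y => H3 H4.
by apply: Rabs_le; lra.
Qed.

Let bounds_ge0 m : (forall x, Rabs (f x - g x) <= m) -> 0 <= m.
Proof. by move=> /(_ x0); apply: Rle_trans; apply: Rabs_pos. Qed.

Lemma le_sup_dist x : Rabs (f x - g x) <= sup_dist f g.
Proof. by apply: (le_glb bounds_ge0 bounds_inh) => m; apply. Qed.

Lemma sup_dist_le m : (forall x, Rabs (f x - g x) <= m) -> sup_dist f g <= m.
Proof. exact: (glb_le bounds_ge0 bounds_inh). Qed.

End SupDist.
End Katetov.

(** * Translation on [nat * G] and new orbits *)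

Definition act (G : zmodType) (g : G) (t : nat * G) : nat * G :=
  (t.1, GRing.add g t.2).

Definition invariant (G : zmodType) (r : nat * G -> nat * G -> R) : Prop :=
  forall g t s, r (act g t) (act g s) = r t s.

Section Act.
Variable G : zmodType.
Implicit Types (g h : G) (t : nat * G).

Lemma actA g h t : act g (act h t) = act (GRing.add g h) t.
Proof. by rewrite /act /= addrA. Qed.

Lemma actC g h t : act g (act h t) = act h (act g t).
Proof. by rewrite !actA addrC. Qed.

Lemma act0 t : act GRing.zero t = t.
Proof. by case: t => i g; rewrite /act add0r. Qed.

Lemma actK g t : act g (act (GRing.opp g) t) = t.
Proof. by rewrite actA subrr act0. Qed.

Lemma actKV g t : act (GRing.opp g) (act g t) = t.
Proof. by rewrite actA addNr act0. Qed.

(* The new orbit [{k} * G] consists of the translates of [f]; the sup distance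
   of Katetov functions agrees with [r] on the functions [r t]. *)
Lemma add_orbit (r : nat * G -> nat * G -> R) (h : G) (f : nat * G -> R) (k : nat) :
  pseudo_metric r -> invariant r -> (forall t, r t (act h t) = 0) -> katetov r f ->
  exists r' : nat * G -> nat * G -> R,
    [/\ pseudo_metric r', invariant r', forall t, r' t (act h t) = 0,
        forall t s, t.1 <> k -> s.1 <> k -> r' t s = r t s &
        forall s, s.1 <> k -> r' (k, GRing.zero) s = f s].
Proof.
move=> r_pm r_inv r_per fK; have [r0 [rC rT]] := r_pm.
pose kap t x := if t.1 == k then f (act (GRing.opp t.2) x) else r t x.
have kapK t : katetov r (kap t).
  rewrite /kap; case: (t.1 == k) => x y; last exact: katetov_dist.
  by rewrite -(r_inv (GRing.opp t.2) x y); apply: fK.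
have kap_act g t x : kap (act g t) x = kap t (act (GRing.opp g) x).
  rewrite /kap /=; case: (t.1 == k); first by rewrite actA opprD addrC.
  by rewrite -(r_inv (GRing.opp g)) actKV.
pose o : nat * G := (0%nat, GRing.zero).
have kub t s x := le_sup_dist r_pm o (kapK t) (kapK s) x.
have kle t s := sup_dist_le r_pm o (kapK t) (kapK s).
exists (fun t s => sup_dist (kap t) (kap s)).
have inv_le g t s : sup_dist (kap (act g t)) (kap (act g s)) <= sup_dist (kap t) (kap s).
  by apply: kle => x; rewrite !kap_act; apply: kub.
have ge0 t s : 0 <= sup_dist (kap t) (kap s).
  by apply: Rle_trans (kub t s o); apply: Rabs_pos.
split.
- split; [|split].
  + move=> t; apply: Rle_antisym => //; apply: kle => x.
    by rewrite Rminus_diag Rabs_R0; apply: Rle_refl.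
  + by move=> t s; apply: Rle_antisym; apply: kle => x; rewrite Rabs_minus_sym; apply: kub.
  + move=> t s u; apply: kle => x.
    apply: Rle_trans (Rplus_le_compat _ _ _ _ (kub t s x) (kub s u x)).
    apply: Rle_trans (Rabs_triang _ _).
    by apply: Req_le; congr Rabs; ring.
- move=> g t s; apply: Rle_antisym => //.
  by rewrite -{1}(actKV g t) -{1}(actKV g s).
(* Katetov functions are 1-Lipschitz, hence agree at points at [r]-distance zero. *)
- move=> t; apply: Rle_antisym => //; apply: kle => x; rewrite kap_act.
  set y := act _ _.
  have Hxy : r y x = 0 by rewrite -(actK h x) r_per.
  have [H1 _] := kapK t x y; have [H2 _] := kapK t y x.
  by rewrite (rC x) Hxy in H1; rewrite Hxy in H2; apply: Rabs_le; lra.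
(* Here and in the next case the supremum is attained at [s], where [r s s = 0]. *)
- move=> t s /eqP/negbTE tk /eqP/negbTE sk; apply: Rle_antisym.
    apply: kle => x; rewrite /kap tk sk; apply: Rabs_le.
    have := rT t s x; have := rT s t x; rewrite (rC s t); lra.
  apply: Rle_trans (kub t s s); rewrite /kap tk sk r0 Rminus_0_r; exact: Rle_abs.
- move=> s /eqP/negbTE sk.
  have Hk x : kap (k, GRing.zero) x = f x by rewrite /kap eqxx /= oppr0 act0.
  apply: Rle_antisym.
    apply: kle => x; rewrite Hk /kap sk; apply: Rabs_le.
    by have := fK x s; have := fK s x; rewrite (rC x s); lra.
  apply: Rle_trans (kub _ _ s); rewrite Hk /kap sk r0 Rminus_0_r; exact: Rle_abs.
Qed.

End Act.

(** * Real-valued homomorphisms *)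

Section Characters.
Variable G : zmodType.

(* The graph of a real-valued homomorphism defined on a subgroup of [G]. *)
Definition partial_char (P : G -> R -> Prop) : Prop :=
  [/\ P GRing.zero 0,
      forall x y u v, P x u -> P y v -> P (GRing.add x (GRing.opp y)) (u - v) &
      forall u, P GRing.zero u -> u = 0].

(** The extension sending [g] to [q]; differences of natural multiples stand for integer multiples
    of [g]. *)
Definition adjoin (P : G -> R -> Prop) (g : G) (q : R) (x : G) (u : R) : Prop :=
  exists y v i j, [/\ P y v,
    x = GRing.add y (GRing.add (GRing.natmul g i) (GRing.opp (GRing.natmul g j))) &
    u = v + (INR i * q - INR j * q)].

Lemma partial_charN P x u : partial_char P -> P x u -> P (GRing.opp x) (- u).
Proof. by case=> P0 PB _ /(PB _ _ _ _ P0); rewrite add0r Rminus_0_l. Qed.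

Lemma partial_charMn P x u n :
  partial_char P -> P x u -> P (GRing.natmul x n) (INR n * u).
Proof.
move=> HP; have [P0 PB _] := HP => Px; elim: n => [|n IH]; first by rewrite Rmult_0_l mulr0n.
have := PB _ _ _ _ IH (partial_charN HP Px).
by rewrite opprK -mulrSr S_INR; congr P; ring.
Qed.

Lemma partial_char_unique P x u v : partial_char P -> P x u -> P x v -> u = v.
Proof.
move=> [_ PB PF] Pu Pv; have := PB _ _ _ _ Pu Pv; rewrite subrr => /PF; lra.
Qed.

Lemma adjoin_sub P g q x u : P x u -> adjoin P g q x u.
Proof.
move=> Px; exists x, u, 0%nat, 0%nat; split=> //; last by rewrite /=; ring.
by rewrite mulr0n subrr addr0.
Qed.

Lemma adjoin_gen P g q : partial_char P -> adjoin P g q g q.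
Proof.
case=> P0 _ _; exists GRing.zero, 0, 1%nat, 0%nat; split=> //; last by rewrite /=; ring.
by rewrite mulr0n mulr1n subr0 add0r.
Qed.

(** Only single-valuedness at zero is at stake. If [y + i g - j g = 0], then [y] or its opposite is
    a natural multiple of [g], according to the order of [i] and [j], and [q] prescribes its
    value. *)
Lemma adjoin_char P g q : partial_char P ->
  (forall n z, P (GRing.natmul g n) z -> z = INR n * q) ->
  partial_char (adjoin P g q).
Proof.
move=> HP Hq; have [P0 PB PF] := HP; split.
- exact: adjoin_sub.
- move=> _ _ _ _ [x [u [i [j [Pxu -> ->]]]]] [y [v [k [l [Pyv -> ->]]]]].
  exists (GRing.add x (GRing.opp y)), (u - v), (i + l)%nat, (j + k)%nat; split.
  + exact: PB.
  + by rewrite !mulrnDr opprD addrACA opprB [X in GRing.add _ X]addrACA -opprD.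
  + by rewrite !plus_INR; ring.
move=> _ [y [v [i [j [Pyv E ->]]]]].
case: (leqP i j) => [ij|/ltnW ij].
  have Ey : y = GRing.natmul g (j - i).
    by move/esym/eqP: E; rewrite mulrnBr // addr_eq0 opprB => /eqP.
  rewrite Ey in Pyv; have -> := Hq _ _ Pyv.
  by rewrite -[in INR j](subnK ij) plus_INR; ring.
have Ey : GRing.opp y = GRing.natmul g (i - j).
  by move/esym/eqP: E; rewrite mulrnBr // addrC addr_eq0 => /eqP <-.
have := partial_charN HP Pyv; rewrite Ey => /Hq Ev.
have -> : v = - (INR (i - j) * q) by lra.
by rewrite -[in INR i](subnK ij) plus_INR; ring.
Qed.

(** If a positive multiple of [g] lies in the domain, dividing its value gives [q], and divisibility
    of the reals makes this consistent. Otherwise any [q] works. *)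
Lemma adjoin_value P g : partial_char P ->
  exists q, forall n z, P (GRing.natmul g n) z -> z = INR n * q.
Proof.
move=> HP; have [P0 _ PF] := HP.
case: (classic (exists n z, P (GRing.natmul g n.+1) z)) => [[n [z Pz]]|none].
  exists (z / INR n.+1) => m w Pw.
  have Hn : INR n.+1 <> 0 by apply: not_0_INR.
  have := partial_charMn m HP Pz; have := partial_charMn n.+1 HP Pw.
  rewrite -!mulrnA mulnC => H1 H2; have := partial_char_unique HP H1 H2.
  by move=> E; apply: (Rmult_eq_reg_l (INR n.+1)) => //; rewrite E; field.
exists 0 => -[|n] z Pz; first by rewrite mulr0n in Pz; rewrite (PF _ Pz) /=; ring.
by case: none; exists n, z.
Qed.

End Characters.

(** Start from the map with value 1 at [a], well defined because [a] has infinite order, adjoin the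
    elements of [G] one by one along their enumeration, and take the union of the graphs. *)
Lemma exists_character (G : countZmodType) (a : G) :
  (forall n, GRing.natmul a n.+1 <> GRing.zero) ->
  exists chi : G -> R, chi a = 1 /\
    forall x y, chi (GRing.add x (GRing.opp y)) = chi x - chi y.
Proof.
move=> a_tf.
pose triv (x : G) (u : R) := x = GRing.zero /\ u = 0.
have triv_char : partial_char triv.
  by split=> [|x y u v [-> ->] [-> ->]|u []] //; split; [rewrite subrr|lra].
have P0_char : partial_char (adjoin triv a 1).
  apply: adjoin_char => // -[|n] z [E ->]; first by rewrite /=; ring.
  by case: (a_tf n).
pose step n (P Q : {P : G -> R -> Prop | partial_char P}) := (forall x u, sval P x u -> sval Q x u) /\
  forall x, unpickle n = Some x -> exists u, sval Q x u.
have [|F [F0 FS]] := @dependent_choice _ step (exist _ _ P0_char).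
  (* When [n] codes no element, zero is adjoined, which is harmless. *)
  move=> n [P HP]; pose g := odflt GRing.zero (unpickle n : option G).
  have [q Hq] := adjoin_value g HP.
  exists (exist _ _ (adjoin_char HP Hq)); split=> /= [x u|x Hx]; first exact: adjoin_sub.
  have -> : x = g by rewrite /g Hx.
  by exists q; apply: adjoin_gen.
have mono m n x u : (m <= n)%nat -> sval (F m) x u -> sval (F n) x u.
  move=> /subnK <-; elim: (n - m)%nat => [|k IH] // /IH.
  by rewrite addSn; apply: (proj1 (FS _)).
have total x : exists u, exists n, sval (F n) x u.
  have [_ /(_ x (pickleK x)) [u Hu]] := FS (pickle x).
  by exists u, (pickle x).+1.
have uniq x u v m n : sval (F m) x u -> sval (F n) x v -> u = v.
  move=> /(mono _ _ _ _ (leq_maxl m n)) Hu /(mono _ _ _ _ (leq_maxr m n)).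
  exact: partial_char_unique (proj2_sig (F _)) Hu.
pose chi x := sval (constructive_indefinite_description _ (total x)).
have chiP x : exists n, sval (F n) x (chi x).
  by rewrite /chi; case: constructive_indefinite_description.
exists chi; split.
  have [n Hn] := chiP a; apply: uniq Hn (_ : sval (F 0%nat) a 1).
  by rewrite F0; apply: adjoin_gen.
move=> x y; have [m Hx] := chiP x; have [n Hy] := chiP y.
have [k Hk] := chiP (GRing.add x (GRing.opp y)).
apply: uniq Hk (_ : sval (F (maxn m n)) _ _).
have [_ PB _] := proj2_sig (F (maxn m n)); apply: PB.
  exact: mono (leq_maxl m n) Hx.
exact: mono (leq_maxr m n) Hy.
Qed.

(** * Quotients of invariant pseudometrics *)

(** The distance between [H]-orbits, [r t s] being the infimum of [D t (act h s)] over [h] in [H].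
    Translating by elements of [H] gives the triangle inequality; commutativity of [G] gives
    invariance under all of [G]. *)
Lemma quotient_metric (G : zmodType) (D : nat * G -> nat * G -> R) (H : G -> Prop) :
  pseudo_metric D -> invariant D -> H GRing.zero ->
  (forall x y, H x -> H y -> H (GRing.add x (GRing.opp y))) ->
  exists r, [/\ pseudo_metric r, invariant r, forall h, H h -> forall t, r t (act h t) = 0,
    forall t s, r t s <= D t s &
    forall t s l, (forall h, H h -> l <= D t (act h s)) -> l <= r t s].
Proof.
move=> D_pm D_inv H0 HB; have [D0 [DC DT]] := D_pm.
have HN x : H x -> H (GRing.opp x) by move=> Hx; rewrite -[GRing.opp x]add0r; apply: HB.
have HD x y : H x -> H y -> H (GRing.add x y).
  by move=> Hx /HN Hy; rewrite -[y]opprK; apply: HB.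
have ge0 t s h : H h -> 0 <= D t (act h s) by move=> _; apply: pseudo_metric_ge0.
have Hne : exists h, H h by exists GRing.zero.
pose r t s := glb H (fun h => D t (act h s)).
have r_le t s h : H h -> r t s <= D t (act h s) by apply: (glb_le (ge0 t s) Hne).
have le_r t s l : (forall h, H h -> l <= D t (act h s)) -> l <= r t s.
  exact: (le_glb (ge0 t s) Hne).
have r_ge0 t s : 0 <= r t s by apply: le_r; apply: ge0.
have r_sym t s : r t s <= r s t.
  apply: le_r => h Hh; apply: Rle_trans (r_le _ _ _ (HN _ Hh)) _.
  by rewrite DC -(D_inv h) actK; apply: Rle_refl.
have r_inv g t s : r (act g t) (act g s) <= r t s.
  apply: le_r => h Hh; apply: Rle_trans (r_le _ _ _ Hh) _.
  by rewrite actC D_inv; apply: Rle_refl.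
exists r; split=> //.
- split; [|split].
  + move=> t; apply: Rle_antisym => //.
    by have := r_le t t _ H0; rewrite act0 D0.
  + by move=> t s; apply: Rle_antisym.
  + move=> x y z; suff : r x z - r y z <= r x y by lra.
    apply: (le_r) => h Hh; suff : r x z - D x (act h y) <= r y z by lra.
    apply: le_r => k Hk; have := r_le x z _ (HD _ _ Hh Hk); rewrite -actA.
    by have := DT x (act h y) (act h (act k z)); rewrite D_inv; lra.
- move=> g t s; apply: Rle_antisym => //.
  by rewrite -{1}(actKV g t) -{1}(actKV g s).
- move=> h Hh t; apply: Rle_antisym => //.
  by have := r_le t (act h t) _ (HN _ Hh); rewrite actKV D0.
- by move=> t s; have := r_le t s _ H0; rewrite act0.
Qed.

(* Below, [D'] agrees with [D] on [K] and goes to infinity along the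
   multiples of [a], so collapsing a large multiple of [a] does not affect [K]. *)
Lemma periodize (G : zmodType) (a : G) (chi : G -> R) (D : nat * G -> nat * G -> R)
    (eps : R) (K : list (nat * G)) :
  chi a = 1 -> (forall x y, chi (GRing.add x (GRing.opp y)) = chi x - chi y) ->
  pseudo_metric D -> invariant D -> 0 < eps -> (forall t s, t <> s -> eps <= D t s) ->
  exists N, forall n, (N <= n)%nat -> exists r,
    [/\ pseudo_metric r, invariant r, forall t, r t (act (GRing.natmul a n) t) = 0 &
        forall t s, In t K -> In s K -> r t s = D t s].
Proof.
move=> chi_a chiB D_pm D_inv eps0 D_sep; have [D0 [DC DT]] := D_pm.
have chi0 : chi GRing.zero = 0 by rewrite -(subrr a) chiB; lra.
have chiN x : chi (GRing.opp x) = - chi x by have := chiB GRing.zero x; rewrite add0r chi0; lra.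
have chiD x y : chi (GRing.add x y) = chi x + chi y.
  by rewrite -[y]opprK chiB chiN opprK; lra.
have chiMn x n : chi (GRing.natmul x n) = INR n * chi x.
  elim: n => [|n IH]; first by rewrite mulr0n chi0 /=; ring.
  by rewrite mulrSr chiD IH S_INR; ring.
pose e (t s : nat * G) := Rabs (chi t.2 - chi s.2).
have [B [B0 HB]] := finite_bound2 e K.
have [M [M0 HM]] := finite_bound2 D K.
(* On [K] this keeps [c * e] at most [eps], hence below [D] at distinct points. The added 1 avoids a
   division by zero. *)
pose c := eps / (B + 1).
have c0 : 0 < c by apply: Rdiv_lt_0_compat; lra.
have cB : c * B <= eps.
  have E : c * B + c = eps by rewrite /c; field; lra.
  by lra.
pose D' t s := Rmax (D t s) (c * e t s).
have D'_pm : pseudo_metric D'.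
  split; [|split]; rewrite /D' /e.
  - by move=> t; rewrite D0 Rminus_diag Rabs_R0 Rmult_0_r Rmax_left //; lra.
  - by move=> t s; rewrite DC Rabs_minus_sym.
  - move=> t s u; apply: Rmax_lub.
      apply: Rle_trans (DT t s u) _; apply: Rplus_le_compat; apply: Rmax_l.
    apply: Rle_trans (_ : c * e t s + c * e s u <= _); last first.
      by apply: Rplus_le_compat; apply: Rmax_r.
    rewrite -Rmult_plus_distr_l; apply: Rmult_le_compat_l; first lra.
    apply: Rle_trans (Rabs_triang _ _); apply: Req_le; congr Rabs; ring.
have D'_inv : invariant D'.
  by move=> g t s; rewrite /D' /e D_inv /= !chiD; congr (Rmax _ (c * Rabs _)); ring.
have D'K t s : In t K -> In s K -> D' t s = D t s.
  move=> Kt Ks; apply: Rmax_left.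
  case: (classic (t = s)) => [->|ts].
    by rewrite /e Rminus_diag Rabs_R0 Rmult_0_r D0; lra.
  apply: Rle_trans (D_sep _ _ ts); apply: Rle_trans cB.
  by apply: Rmult_le_compat_l (HB _ _ Kt Ks); lra.
(* A nonzero multiple of [n a] shifts [chi] by at least [n], while [chi] varies by at most [B] on
   [K]. The remaining gap of [M / c], multiplied by [c], exceeds every [D]-distance in [K]. *)
have [N HN] := INR_unbounded (B + M / c).
exists N => n Nn; set b := GRing.natmul a n.
pose H h := exists i j, h = GRing.add (GRing.natmul b i) (GRing.opp (GRing.natmul b j)).
have [||r [r_pm r_inv r_per r_le le_r]] := @quotient_metric _ D' H D'_pm D'_inv.
- by exists 0%nat, 0%nat; rewrite subrr.
- move=> _ _ [i [j ->]] [k [l ->]]; exists (i + l)%nat, (j + k)%nat.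
  by rewrite !mulrnDr opprB opprD addrACA.
exists r; split=> // [t|t s Kt Ks].
  apply: r_per; exists 1%nat, 0%nat; by rewrite mulr0n subr0.
apply: Rle_antisym; first by rewrite -D'K.
apply: le_r => _ [i [j ->]].
case: (eqVneq i j) => [->|ij].
  by rewrite subrr act0 D'K //; apply: Rle_refl.
apply: Rle_trans (Rmax_r _ _); apply: Rle_trans (HM _ _ Kt Ks) _.
rewrite /e /= chiD chiB !chiMn chi_a.
have HBts := HB _ _ Kt Ks.
have n1 : INR N <= INR n by apply: le_INR; apply/leP.
have n2 : INR n <= Rabs (INR i * (INR n * 1) - INR j * (INR n * 1)).
  have -> : INR i * (INR n * 1) - INR j * (INR n * 1) = INR n * (INR i - INR j) by ring.
  rewrite Rabs_mult Rabs_pos_eq; last exact: pos_INR.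
  rewrite -[X in X <= _]Rmult_1_r; apply: Rmult_le_compat_l; first exact: pos_INR.
  case: (ltngtP i j) ij => // ij _.
    by have := le_INR _ _ (leP ij); rewrite S_INR Rabs_minus_sym => ?; apply: Rle_trans (Rle_abs _); lra.
  by have := le_INR _ _ (leP ij); rewrite S_INR => ?; apply: Rle_trans (Rle_abs _); lra.
set z := INR i * _ - _ in n2 *.
have H3 : Rabs z <= Rabs (chi t.2 - (z + chi s.2)) + e t s.
  rewrite /e -(Rabs_Ropp (chi t.2 - (z + chi s.2))); apply: Rle_trans (Rabs_triang _ _).
  by apply: Req_le; congr Rabs; ring.
have E : M = c * (M / c) by field; lra.
by rewrite {1}E; apply: Rmult_le_compat_l; lra.
Qed.

(** * Finite configurations in the Urysohn space *)

Section Urysohn.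
Variables (U : Type) (d : U -> U -> R).
Hypothesis HU : is_urysohn_space d.

Let d_pm : pseudo_metric d.
Proof. by apply: metric_pseudo; case: HU. Qed.

Definition isometric_on (X : Type) (r : X -> X -> R) (A : list X) (phi : X -> U) :=
  forall x y, In x A -> In y A -> d (phi x) (phi y) = r x y.

Lemma realize_katetov (X : Type) (r : X -> X -> R) (A : list X) (phi : X -> U) f :
  isometric_on r A phi -> katetov_on r (fun x => In x A) f ->
  exists y, forall x, In x A -> d y (phi x) = f x.
Proof.
move=> Hphi fK.
case: (classic (exists x, In x A)) => [[x0 Ax0]|A0]; last first.
  have [_ [_ [[s _] _]]] := HU; exists (s 0%nat) => x Ax.
  by case: A0; exists x.
have HI (i : 'I_(length A)) : In (List.nth i A x0) A.
  by apply: nth_In; apply/ltP.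
have [_ [_ [_ ext]]] := HU.
have [i j|y Hy] := ext _ (fun i : 'I_(length A) => phi (List.nth i A x0))
    (fun i => f (List.nth i A x0)).
  by rewrite Hphi //; apply: fK.
exists y => x /(@In_nth _ _ _ x0) [i [/ltP Hi <-]].
exact: (Hy (Ordinal Hi)).
Qed.

(** Points of [B] are placed one at a time: [r x] is a Katetov function on the points already
    placed, so some point of [U] realizes it. *)
Lemma extend_isometric (X : Type) (r : X -> X -> R) (A B : list X) (phi : X -> U) :
  pseudo_metric r -> isometric_on r A phi ->
  exists phi', (forall x, In x A -> phi' x = phi x) /\ isometric_on r (app B A) phi'.
Proof.
move=> r_pm Hphi; have [r0 [rC rT]] := r_pm.
elim: B => [|x B [phi' [Heq Hiso]]] /=; first by exists phi.
have [x_in|x_out] := classic (In x (app B A)).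
  exists phi'; split=> // y z Hy Hz; apply: Hiso.
    by case: Hy => [<-|].
  by case: Hz => [<-|].
have [y z Hy Hz|u Hu] := realize_katetov (f := r x) Hiso.
  exact: katetov_dist.
pose phi2 y := if excluded_middle_informative (y = x) then u else phi' y.
have phi2x : phi2 x = u by rewrite /phi2; case: excluded_middle_informative.
have phi2E y : In y (app B A) -> phi2 y = phi' y.
  by rewrite /phi2; case: excluded_middle_informative => //= -> /x_out.
exists phi2; split=> [y Ay|y z].
  rewrite phi2E ?Heq //; apply/in_app_iff; by right.
have [d0 [dC _]] := d_pm.
case=> [<-|Hy] [<-|Hz]; rewrite ?phi2x ?d0 ?r0 //.
- by rewrite phi2E // Hu.
- by rewrite phi2E // dC Hu.
- by rewrite !phi2E // Hiso.
Qed.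

(** The added [eps] keeps distinct indices uniformly apart even where [q] is not injective. *)
Definition perturbed (X : eqType) (q : X -> U) (eps : R) (x y : X) : R :=
  if x == y then 0 else d (q x) (q y) + eps.

Lemma perturbed_pseudo (X : eqType) (q : X -> U) eps :
  0 < eps -> pseudo_metric (perturbed q eps).
Proof.
move=> eps0; have [d0 [dC dT]] := d_pm; have dp := pseudo_metric_ge0 d_pm.
split; [|split]; rewrite /perturbed.
- by move=> x; rewrite eqxx.
- by move=> x y; rewrite (eq_sym x y) (dC (q x)).
move=> x y z; case: (eqVneq x y) => [->|_]; first by lra.
case: (eqVneq y z) => [<-|_]; first by case: (x == y); have := dp (q x) (q y); lra.
have := dp (q x) (q y); have := dp (q y) (q z); have := dT (q x) (q y) (q z).
by case: (x == z); lra.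
Qed.

(** Moving each of two points by [eps / 2] leaves room to increase their distance by [eps]. *)
Lemma perturbed_embedding (X : eqType) (q : X -> U) (eps : R) (K : list X) :
  0 < eps -> exists phi, (forall x, In x K -> d (phi x) (q x) < eps) /\
    isometric_on (perturbed q eps) K phi.
Proof.
move=> eps0; have [d0 [dC dT]] := d_pm; have dp := pseudo_metric_ge0 d_pm.
have [p0 [pC pT]] := perturbed_pseudo q eps0.
have ple x y : perturbed q eps x y <= d (q x) (q y) + eps.
  by rewrite /perturbed; case: (x == y); have := dp (q x) (q y); lra.
have pge x y : d (q x) (q y) <= perturbed q eps x y.
  by rewrite /perturbed; case: eqP => [->|_]; rewrite ?d0; lra.
(* The points [q x] and their copies at distance [eps / 2] in one space. *)
pose r (a b : U + X) := match a, b with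
  | inl u, inl v => d u v
  | inl u, inr x | inr x, inl u => d u (q x) + eps / 2
  | inr x, inr y => perturbed q eps x y
  end.
have r_pm : pseudo_metric r.
  split; [|split].
  - by case=> x /=; rewrite ?d0 ?p0.
  - by case=> x [] y //=.
  case=> x [] y [] z //=.
  + by have := dT x y (q z); lra.
  + by have := dT x (q y) z; rewrite (dC z); lra.
  + by have := dT x (q y) (q z); have := pge y z; lra.
  + by have := dT z y (q x); rewrite (dC z y); lra.
  + by have := dT (q x) y (q z); have := ple x z; rewrite (dC (q x) y); lra.
  + by have := dT z (q y) (q x); have := pge x y; rewrite (dC (q x) (q y)); lra.
pose A : list (U + X) := List.map (fun x => inl (q x)) K.
pose B : list (U + X) := List.map (fun x => inr x) K.
have [|phi [Heq Hiso]] := @extend_isometric _ r A B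
    (fun a => match a with inl u => u | inr x => q x end) r_pm.
  by move=> x y /in_map_iff [x' [<- _]] /in_map_iff [y' [<- _]].
have inA x : In x K -> In (inl (q x)) A by move=> Kx; apply/in_map_iff; exists x.
have inB x : In x K -> In (inr x) (app B A).
  by move=> Kx; apply/in_app_iff; left; apply/in_map_iff; exists x.
exists (fun x => phi (inr x)); split=> [x Kx|x y Kx Ky]; last exact: Hiso (inB _ Kx) (inB _ Ky).
rewrite -[q x](Heq _ (inA _ Kx)) Hiso /= ?d0; [lra | exact: inB |].
by apply/in_app_iff; right; apply: inA.
Qed.

(** * From invariant pseudometrics to actions *)

Lemma fresh_index (X : Type) (A : list (nat * X)) :
  exists k, forall t, In t A -> t.1 <> k.
Proof.
suff [k Hk] : exists k, forall t, In t A -> (t.1 < k)%nat.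
  by exists k => t /Hk tk tE; rewrite tE ltnn in tk.
elim: A => [|t A [k Hk]]; first by exists O.
exists (maxn k t.1.+1) => s /= [<-|/Hk]; first by rewrite leq_maxr.
by move=> sk; apply: leq_trans sk (leq_maxl _ _).
Qed.

(** A state consists of a periodic invariant pseudometric, the finite list of points placed so far,
    and their images. Stage [n] places the point coded by [n], then puts [s n] into the image as the
    base point of a fresh orbit. The pseudometric may change later, but never between placed
    points. *)
Lemma complete_orbits (G : countZmodType) (r : nat * G -> nat * G -> R) (h : G)
    (K : list (nat * G)) (phi : nat * G -> U) :
  pseudo_metric r -> invariant r -> (forall t, r t (act h t) = 0) ->
  isometric_on r K phi ->
  exists psi : nat * G -> U,
    [/\ forall t, In t K -> psi t = phi t, invariant (fun t s => d (psi t) (psi s)),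
        forall t, psi (act h t) = psi t &
        forall u eps, 0 < eps -> exists t, d u (psi t) < eps].
Proof.
move=> r_pm r_inv r_per Hphi; have [d_m [_ [[s s_dense] _]]] := HU.
pose state := ((nat * G -> nat * G -> R) * list (nat * G) * (nat * G -> U))%type.
pose good (S : state) := [/\ pseudo_metric S.1.1, invariant S.1.1,
  forall t, S.1.1 t (act h t) = 0 & isometric_on S.1.1 S.1.2 S.2].
pose step n (S S' : {S | good S}) :=
  let: (_, A, f) := sval S in let: (_, A', f') := sval S' in
  [/\ forall t, In t A -> In t A' /\ f' t = f t,
      forall t, unpickle n = Some t -> In t A' &
      exists t, In t A' /\ f' t = s n].
have good0 : good (r, K, phi) by split.
have [|F [F0 FS]] := @dependent_choice _ step (exist _ _ good0).
  move=> n [[[r1 A1] f1] [/= r_pm1 inv1 per1 iso1]].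
  (* Placing a default point when [n] codes none keeps [A2] nonempty, as the Katetov extension
     requires. *)
  pose t := odflt (O, GRing.zero) (unpickle n : option (nat * G)).
  have [f2 [f2E iso2]] := extend_isometric [:: t] r_pm1 iso1.
  set A2 := app _ _ in iso2.
  have A2t : In t A2 by left.
  have [k k_fresh] := fresh_index A2.
  pose f x := d (s n) (f2 x).
  have fK : katetov_on r1 (fun x => In x A2) f.
    move=> x y Ax Ay; rewrite -iso2 //; exact: katetov_dist d_pm (s n) _ _.
  have fne : exists x, In x A2 by exists t.
  have [r3 [pm3 inv3 per3 r3E r3k]] :=
    add_orbit k r_pm1 inv1 per1 (katetov_ext_katetov r_pm1 fne fK).
  pose f3 x := if x == (k, GRing.zero) then s n else f2 x.
  have f3E x : In x A2 -> f3 x = f2 x.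
    by rewrite /f3; case: eqP => // -> /k_fresh.
  have f3k : f3 (k, GRing.zero) = s n by rewrite /f3 eqxx.
  have good3 : good (r3, (k, GRing.zero) :: A2, f3).
    have [d0 [dC _]] := d_pm; have [r0 [rC _]] := pm3.
    split=> //= x y [<-|Ax] [<-|Ay]; rewrite ?f3k ?d0 ?r0 ?f3E //.
    - by rewrite r3k ?katetov_ext_id //; apply: k_fresh.
    - by rewrite dC rC r3k ?katetov_ext_id //; apply: k_fresh.
    - by rewrite iso2 // r3E //; apply: k_fresh.
  exists (exist _ _ good3); split=> /=.
  - move=> x Ax; have Ax2 : In x A2 by right.
    by split; [right | rewrite f3E // f2E].
  - by move=> x Hx; right; left; rewrite /t Hx.
  - by exists (k, GRing.zero); split; [left | ].
pose A n := (sval (F n)).1.2; pose f n := (sval (F n)).2.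
have mono m n t : (m <= n)%nat -> In t (A m) -> In t (A n) /\ f n t = f m t.
  move=> /subnK <-; elim: (n - m)%nat => [|k IH] // At; have [Ak <-] := IH At.
  have := FS (k + m)%nat; rewrite /step /A /f addSn.
  move: Ak; rewrite /A.
  by case: (sval (F (k + m)%nat)) => [[? ?] ?]; case: (sval (F _)) => [[? ?] ?] /= Ak [H _ _]; apply: H.
have enum t : In t (A (pickle t).+1).
  have := FS (pickle t); rewrite /step /A.
  case: (sval (F (pickle t))) => [[? ?] ?]; case: (sval (F _)) => [[? ?] ?] /= [_ H _].
  by apply: H; rewrite pickleK.
(* Stage [pickle t] places [t], so its image is final from the next state on. *)
exists (fun t => f (pickle t).+1 t).
have psiE t n : (pickle t < n)%nat -> In t (A n) /\ f n t = f (pickle t).+1 t.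
  by move=> tn; apply: mono.
have psi_dist t1 t2 n : (pickle t1 < n)%nat -> (pickle t2 < n)%nat ->
    d (f (pickle t1).+1 t1) (f (pickle t2).+1 t2) = (sval (F n)).1.1 t1 t2.
  move=> /psiE [A1 <-] /psiE [A2 <-].
  have [_ _ _] := proj2_sig (F n); exact.
split.
- move=> t Kt; have [||_] := mono 0%nat (pickle t).+1 t => //; by rewrite /A /f F0.
- move=> g t1 t2.
  (* By this stage all four points are placed, so one invariant pseudometric computes both
     distances. *)
  pose n := (maxn (maxn (pickle t1) (pickle t2)) (maxn (pickle (act g t1)) (pickle (act g t2)))).+1.
  rewrite !(psi_dist _ _ n) ?ltnS ?leq_max ?leqnn ?orbT //.
  have [_ inv _ _] := proj2_sig (F n); exact: inv.
- move=> t; have [_ [d0 _]] := d_m; apply/d0; have [_ [dC _]] := d_pm.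
  pose n := (maxn (pickle t) (pickle (act h t))).+1.
  rewrite dC (psi_dist _ _ n) ?ltnS ?leq_max ?leqnn ?orbT //.
  have [_ _ per _] := proj2_sig (F n); exact: per.
move=> u eps /(s_dense u) [n Hn].
have [t [At ft]] : exists t, In t (A n.+1) /\ f n.+1 t = s n.
  have := FS n; rewrite /step /A /f.
  by case: (sval (F n)) => [[? ?] ?]; case: (sval (F _)) => [[? ?] ?] /= [_ _].
exists t; rewrite (_ : f _ t = s n) // -ft.
have [_ <-] := psiE t (maxn (pickle t) n).+1 (leq_maxl _ _).
by have [] := @mono n.+1 (maxn (pickle t) n).+1 t (leq_maxr _ _) At.
Qed.

(** By completeness each translation extends from the dense set of orbit points. The image of [u] is
    characterized by its distances to orbit points, so the action laws are checked on those
    distances. *)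
Lemma action_of_orbits (G : zmodType) (psi : nat * G -> U) :
  invariant (fun t s => d (psi t) (psi s)) ->
  (forall u eps, 0 < eps -> exists t, d u (psi t) < eps) ->
  exists p : HomT G U d, (forall g t, proj1_sig p g (psi t) = psi (act g t)) /\
    forall h, (forall t, psi (act h t) = psi t) -> forall u, proj1_sig p h u = u.
Proof.
move=> psi_inv dense; have [[_ [d_eq _]] [compl _]] := HU.
have [d0 [dC dT]] := d_pm.
have ex g u : exists v, forall t, d v (psi (act g t)) = d u (psi t).
  have /(_ _)/constructive_indefinite_description ch n :
    exists t, d u (psi t) < / INR n.+1.
    by apply: dense; apply: Rinv_0_lt_compat; apply: lt_0_INR; apply/ltP.
  pose t n := sval (ch n).
  have tP n : d u (psi (t n)) < / INR n.+1 by rewrite /t; case: (ch n).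
  have small eps : 0 < eps -> exists N, forall n, (N <= n)%nat -> d u (psi (t n)) < eps.
    move=> /archimed_cor1 [N [HN /ltP N0]]; exists N => n Nn.
    apply: Rlt_trans (tP n) _; apply: Rle_lt_trans HN; apply: Rinv_le_contravar.
      by apply: lt_0_INR; apply/ltP.
    by apply: le_INR; apply/leP; apply: leqW.
  have [|v Hv] := compl (fun n => psi (act g (t n))).
    move=> eps eps0; have [|N HN] := small (eps / 2); first by lra.
    exists N => m n /HN Hm /HN Hn; rewrite psi_inv.
    have := dT (psi (t m)) u (psi (t n)); rewrite (dC _ u); lra.
  exists v => x; apply: cond_eq => eps eps0.
  have [|N1 H1] := small (eps / 2); first by lra.
  have [|N2 H2] := Hv (eps / 2); first by lra.
  have := H1 _ (leq_maxl N1 N2); have := H2 _ (leq_maxr N1 N2).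
  set n := maxn _ _ => {}H2 {}H1; have E := psi_inv g (t n) x.
  have := dT v (psi (act g (t n))) (psi (act g x)).
  have := dT (psi (act g (t n))) v (psi (act g x)).
  have := dT u (psi (t n)) (psi x); have := dT (psi (t n)) u (psi x).
  rewrite (dC v (psi (act g (t n)))) (dC (psi (t n)) u) => *.
  by apply: Rabs_def1; lra.
(* A point is determined by its distances to a dense set. *)
have uniq u v : (forall t, d u (psi t) = d v (psi t)) -> u = v.
  move=> H; apply/d_eq; apply: cond_eq => eps eps0.
  have [|t Ht] := dense u (eps / 2); first by lra.
  have := H t; have := dT u (psi t) v; rewrite (dC (psi t) v).
  have := pseudo_metric_ge0 d_pm u v.
  by move=> *; apply: Rabs_def1; lra.
pose p g u := sval (constructive_indefinite_description _ (ex g u)).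
have pE g u t : d (p g u) (psi (act g t)) = d u (psi t).
  by rewrite /p; case: constructive_indefinite_description.
have pE' g u t : d (p g u) (psi t) = d u (psi (act (GRing.opp g) t)).
  by rewrite -[RHS](pE g) actK.
have pD a b x : p (GRing.add a b) x = p a (p b x).
  by apply: uniq => t; rewrite !pE' actA opprD addrC.
have p0 x : p GRing.zero x = x by apply: uniq => t; rewrite pE' oppr0 act0.
have p_hom : is_hom d p.
  split=> // a; split=> [x y|y]; last by exists (p (GRing.opp a) y); rewrite -pD subrr p0.
  apply: cond_eq => eps eps0.
  have [|t Ht] := dense y (eps / 2); first by lra.
  have := pE a x t; have := pE a y t.
  have := dT (p a x) (psi (act a t)) (p a y); have := dT (p a x) (p a y) (psi (act a t)).
  have := dT x (psi t) y; have := dT x y (psi t).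
  rewrite (dC (psi t) y) (dC (psi (act a t)) (p a y)) => *.
  by apply: Rabs_def1; lra.
exists (exist _ p p_hom); split=> /= [g t|h Hh u]; apply: uniq => s.
  by rewrite pE' -(psi_inv (GRing.opp g) (act g t)) actKV.
by rewrite pE' -[in RHS](actK h s) Hh.
Qed.

(** * Approximating a given action *)

Lemma hom0 (G : zmodType) (p : HomT G U d) u : proj1_sig p GRing.zero u = u.
Proof.
have [iso add] := proj2_sig p; have [[_ [d_eq _]] _] := HU.
apply/d_eq; rewrite -(proj1 (iso GRing.zero)) -add addr0; exact: (proj1 d_pm).
Qed.

(* Orbit [i] of [q] is the [p]-orbit of the point of the [i]-th pair of [F]. *)
Lemma approximate_hom (G : countZmodType) (p : HomT G U d) (F : list (G * U)) eps (b : G) :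
  0 < eps -> exists (q : nat * G -> U) (K : list (nat * G)),
    invariant (perturbed q (eps / 2)) /\
    forall r h, pseudo_metric r -> invariant r -> (forall t, r t (act h t) = 0) ->
    (forall t s, In t K -> In s K -> r t s = perturbed q (eps / 2) t s) ->
    exists p' : HomT G U d,
      [/\ forall gx, In gx F -> d (proj1_sig p' gx.1 gx.2) (proj1_sig p gx.1 gx.2) < eps,
          forall u, proj1_sig p' h u = u &
          b <> GRing.zero -> exists u, proj1_sig p' b u <> u].
Proof.
move=> eps0; have [d0 [dC dT]] := d_pm.
have [_ [_ [[s _] _]]] := HU.
pose F_ i := List.nth i F (GRing.zero, s 0%nat).
pose q (t : nat * G) := proj1_sig p t.2 (F_ t.1).2.
(* For nonzero [b] these are distinct points of orbit 0, so [perturbed] separates them and [b] acts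
   nontrivially. If [F] is empty, orbit 0 is that of the default point [s 0]. *)
pose o : nat * G := (0%nat, GRing.zero); pose ob : nat * G := (0%nat, b).
pose pts i : list (nat * G) := [:: (i, GRing.zero); (i, (F_ i).1)].
pose K := [:: o, ob & List.flat_map pts (List.seq 0 (length F))].
have [iso add] := proj2_sig p.
exists q, K; split=> [g [i x] [j y]|r h r_pm r_inv r_per rK].
  rewrite /perturbed /act /q /= !xpair_eqE (inj_eq (addrI g)).
  by rewrite !add (proj1 (iso g)).
have [|phi [phi_near phi_iso]] := @perturbed_embedding _ q (eps / 2) K; first by lra.
have [|psi [psiK psi_inv psi_per psi_dense]] := complete_orbits r_pm r_inv r_per (K := K) (phi := phi).
  by move=> t u Kt Ku; rewrite rK // phi_iso.
have [p' [p'E p'_id]] := action_of_orbits psi_inv psi_dense.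
exists p'; split.
- move=> gx /(@In_nth _ _ _ (GRing.zero, s 0%nat)) [i [/ltP Fi Ei]].
  have inK t : In t (pts i) -> In t K.
    move=> Ht; right; right; apply/in_flat_map; exists i; split=> //.
    by apply/in_seq; split; [apply/leP | apply/ltP].
  have near t : In t (pts i) -> d (psi t) (q t) < eps / 2.
    by move=> /inK Ht; rewrite psiK //; apply: phi_near.
  (* [w] is within [eps / 2] of the point of the pair, and its [p']-image within [eps / 2] of the
     target; as [p'] is isometric, the errors add up to less than [eps]. *)
  pose w := psi (i, GRing.zero).
  have near0 : d w gx.2 < eps / 2.
    by have := near (i, GRing.zero) (or_introl erefl); rewrite /q /= hom0 /F_ Ei.
  have near1 : d (proj1_sig p' gx.1 w) (proj1_sig p gx.1 gx.2) < eps / 2.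
    have := near (i, (F_ i).1) (or_intror (or_introl erefl)).
    by rewrite /q /F_ Ei /= p'E /act /= addr0.
  have [iso' _] := proj2_sig p'; have := proj1 (iso' gx.1) gx.2 w; rewrite (dC gx.2).
  have := dT (proj1_sig p' gx.1 gx.2) (proj1_sig p' gx.1 w) (proj1_sig p gx.1 gx.2).
  by lra.
- exact: p'_id.
move=> b0; exists (psi o); have -> : proj1_sig p' b (psi o) = psi ob.
  by rewrite p'E /act /= addr0.
have Ko : In o K by left.
have Kob : In ob K by right; left.
move=> E; have := phi_iso ob o Kob Ko; rewrite -!psiK // E d0 /perturbed.
rewrite xpair_eqE /=; case: eqP => // _.
have := pseudo_metric_ge0 d_pm (q ob) (q o); lra.
Qed.

Lemma approximate_periodic (G : countZmodType) (p : HomT G U d) (F : list (G * U)) eps (a : G) :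
  (forall n, GRing.natmul a n.+1 <> GRing.zero) -> 0 < eps ->
  exists N, forall n, (N <= n)%nat -> exists p' : HomT G U d,
    (forall gx, In gx F -> d (proj1_sig p' gx.1 gx.2) (proj1_sig p gx.1 gx.2) < eps) /\
    forall u, proj1_sig p' (GRing.natmul a n) u = u.
Proof.
move=> a_tf eps0; have [q [K [q_inv H]]] := approximate_hom p F a eps0.
have [chi [chi_a chiB]] := exists_character a_tf.
have eps2 : 0 < eps / 2 by lra.
have sep t s : t <> s -> eps / 2 <= perturbed q (eps / 2) t s.
  move=> ts; rewrite /perturbed; case: eqP => // _.
  have := pseudo_metric_ge0 d_pm (q t) (q s); lra.
have [N HN] := periodize K chi_a chiB (perturbed_pseudo q eps2) q_inv eps2 sep.
exists N => n /HN [r [r_pm r_inv r_per rK]].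
have [p' [near p'_id _]] := H r _ r_pm r_inv r_per rK.
by exists p'.
Qed.

Lemma approximate_nontrivial (G : countZmodType) (p : HomT G U d) (F : list (G * U)) eps (a : G) :
  a <> GRing.zero -> 0 < eps -> exists p' : HomT G U d,
    (forall gx, In gx F -> d (proj1_sig p' gx.1 gx.2) (proj1_sig p gx.1 gx.2) < eps) /\
    exists u, proj1_sig p' a u <> u.
Proof.
move=> a0 eps0; have [q [K [q_inv H]]] := approximate_hom p F a eps0.
have eps2 : 0 < eps / 2 by lra.
have pm := perturbed_pseudo q eps2.
(* With zero as the period, the perturbed metric itself qualifies without a quotient. *)
have [||p' [near _ nontriv]] := H _ GRing.zero pm q_inv => //.
  by move=> t; rewrite act0; apply: (proj1 pm).
by exists p'; split=> //; apply: nontriv.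
Qed.

(** * Category and conjugacy classes *)

(** A condition on a single value [q g u] is open, so intersecting it with the given open set yields
    the required smaller one. *)
Lemma nowhere_dense_criterion (G : zmodType) (N : HomT G U d -> Prop) :
  (forall (p : HomT G U d) (F : list (G * U)) eps, 0 < eps ->
    exists (p' : HomT G U d) g u delta,
    [/\ forall gx, In gx F -> d (proj1_sig p' gx.1 gx.2) (proj1_sig p gx.1 gx.2) < eps,
        0 < delta &
        forall q : HomT G U d, d (proj1_sig q g u) (proj1_sig p' g u) < delta -> ~ N q]) ->
  nowhere_dense (@hom_open G U d) N.
Proof.
move=> H O O_open [p Op]; have [d0 [dC dT]] := d_pm.
have [F [eps [eps0 ball]]] := O_open p Op.
have [p' [g [u [delta [near delta0 avoid]]]]] := H p F eps eps0.
exists (fun q : HomT G U d => O q /\ d (proj1_sig q g u) (proj1_sig p' g u) < delta).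
split; [|split].
- move=> q [/O_open [F1 [e1 [e10 ball1]]] qd].
  exists ((g, u) :: F1), (Rmin e1 (delta - d (proj1_sig q g u) (proj1_sig p' g u))).
  split; first by apply: Rmin_pos; lra.
  move=> q' Hq'; split.
    apply: ball1 => gx Hgx; apply: Rlt_le_trans (Hq' _ _) (Rmin_l _ _); by right.
  have := Hq' (g, u) (or_introl erefl) => /= Hgu.
  have := Rlt_le_trans _ _ _ Hgu (Rmin_r _ _).
  by have := dT (proj1_sig q' g u) (proj1_sig q g u) (proj1_sig p' g u); lra.
- by exists p'; split; [apply: ball | rewrite d0].
- by move=> q [Oq /avoid].
Qed.
End Urysohn.

Theorem theorem8p10 (G : countZmodType)
  (Gnontriv : exists a : G, a != GRing.zero)
  (Gtf : forall (a : G) (n : nat), GRing.natmul a n.+1 = GRing.zero -> a = GRing.zero)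
  (U : Type) (d : U -> U -> R) (HU : is_urysohn_space d) :
  forall p : HomT G U d, meager (@hom_open G U d) (conj_orbit p).
Proof.
move=> p; have [a /eqP a0] := Gnontriv.
have a_tf n : GRing.natmul a n.+1 <> GRing.zero by move/Gtf.
have [d_m [_ [[s s_dense] _]]] := HU; have [_ [d_eq _]] := d_m.
have d_pm := metric_pseudo d_m; have [d0 [dC dT]] := d_pm.
case: (classic (forall x, proj1_sig p a x = x)) => [pa|/not_all_ex_not [x pax]].
  (* One nowhere dense set contains the whole orbit, hence the constant sequence. *)
  exists (fun _ (q : HomT G U d) => forall x, proj1_sig q a x = x).
  split=> [_|q [g [ginv [_ [gK [_ qE]]]]]]; last by exists 0%nat => x; rewrite qE pa gK.
  apply: (nowhere_dense_criterion HU) => p0 F eps eps0.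
  have [p' [near [u pu]]] := approximate_nontrivial HU p0 F a0 eps0.
  have du : 0 < d (proj1_sig p' a u) u.
    case: (pseudo_metric_ge0 d_pm (proj1_sig p' a u) u) => // /esym E.
    by case: pu; apply/d_eq.
  exists p', a, u, (d (proj1_sig p' a u) u); split=> // q.
  by move=> Hq Nq; move: Hq; rewrite Nq dC; lra.
set r := d (proj1_sig p a x) x.
have r0 : 0 < r.
  case: (pseudo_metric_ge0 d_pm (proj1_sig p a x) x) => // /esym E.
  by case: pax; apply/d_eq.
have [p_iso p_add] := proj2_sig p.
pose S n := r / 2 <= d (proj1_sig p (GRing.natmul a n) x) x.
(* If neither [n] nor [n.+1] is in [S] then [x] moves less than [r] under [a]. *)
have S_inf N : exists n, (N <= n)%nat /\ S n.
  pose y := proj1_sig p (GRing.natmul a N) x.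
  case: (Rle_lt_dec (r / 2) (d y x)) => [HN|HN]; first by exists N.
  exists N.+1; split; first exact: leqnSn.
  have -> : S N.+1 = (r / 2 <= d (proj1_sig p a y) x) by rewrite /S mulrS p_add.
  have := proj1 (p_iso a) x y; have := dT (proj1_sig p a x) (proj1_sig p a y) x.
  by rewrite -/r (dC x); lra.
(* A conjugate by [g] moves [g x] by at least [r / 2] at all times in [S]. Replacing [g x] by some
   [s j] within [r / 8] costs at most [r / 4] and leaves countably many sets. *)
exists (fun j (q : HomT G U d) => forall n, S n ->
  r / 4 <= d (proj1_sig q (GRing.natmul a n) (s j)) (s j)); split.
  move=> j; apply: (nowhere_dense_criterion HU) => p0 F eps eps0.
  have [N HN] := approximate_periodic HU p0 F a_tf eps0.
  have [n [Nn Sn]] := S_inf N; have [p' [near p'_id]] := HN n Nn.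
  (* [p'] fixes [s j] at time [n], so nearby actions move it by less than [r / 4]. *)
  exists p', (GRing.natmul a n), (s j), (r / 4); split=> //; first by lra.
  by move=> q Hq /(_ n Sn); rewrite p'_id in Hq; lra.
move=> q [g [ginv [g_iso [_ [ginvK qE]]]]].
have [|j Hj] := s_dense (g x) (r / 8); first by lra.
exists j => n Sn; set y := proj1_sig q _.
have y_iso : Defs.isometry d y by have [q_iso _] := proj2_sig q; apply: (proj1 (q_iso _)).
have : r / 2 <= d (y (g x)) (g x) by rewrite /y qE ginvK g_iso.
have := dT (y (g x)) (y (s j)) (g x); have := dT (y (s j)) (s j) (g x).
by rewrite y_iso (dC (s j)); lra.
Qed.
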